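(* Let $G=(A,B,E)$ be a bipartite graph with $n$ vertices and maximum matching $M^*$, whose edges arrive as a stream $\pi$ in an arbitrary order. Consider the following two-pass algorithm: (1) first pass: compute in parallel $M_0\gets\mathrm{Greedy}(\pi)$ and $S\gets\mathrm{SEMI}(3)$, where $\mathrm{SEMI}(\lambda)$ starts with $S=\emptyset$ and upon arrival of edge $ab$ ($a\in A$, $b\in B$) adds $ab$ to $S$ if $\deg_S(a)=0$ and $\deg_S(b)\le\lambda-1$; (2) $M_1\gets\{e\in S: e \text{ goes between } B(M_0) \text{ and } A\setminus A(M_0)\}$; (3) $A_2\gets\{a\in A(M_0): \exists b,c \text{ with } ab\in M_0 \text{ and } bc\in M_1\}$; (4) $F\gets$ the set of pairs between $A_2$ and $B\setminus B(M_0)$; (5) second pass: $M_2\gets\mathrm{Greedy}(F\cap\pi)$; (6) return the matching $M$ obtained from $M_0$ by augmenting with $M_1$ and $M_2$ (for every $da\in M_2$, with $ab\in M_0$, choose an edge $bc\in M_1$, remove $ab$ and add $da$ and $bc$). Then this is a deterministic two-pass semi-streaming algorithm for maximum bipartite matching that, for every bipartite graph and every arrival order, returns a matching of size at least $(\frac12+0.019)|M^*|$, and it can be implemented with $O(1)$ processing time per edge.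
   Context: A $k$-pass semi-streaming algorithm receives the edges of an $n$-vertex graph as a stream, performs at most $k$ passes over the stream, uses memory $O(n\,\mathrm{polylog}\, n)$, and has running time $O(t)$ per edge. $\mathrm{Greedy}(\sigma)$ for a sequence $\sigma$ of edges: start with $M=\emptyset$ and, processing edges in order, add edge $e$ to $M$ whenever $M\cup\{e\}$ is still a matching; output $M$. For a set $F$ of vertex pairs and a stream $\sigma$, $F\cap\sigma$ is the subsequence of $\sigma$ of edges in $F$. For a vertex set $S'$ and edge set $F'$, $S'(F')$ denotes the vertices of $S'$ covered by $F'$; $\deg_S(v)$ is the number of edges of $S$ incident to $v$. The sets $A,B$ are known in advance. *)

(* Defs.v *)
From HB Require Import structures.
From mathcomp Require Import all_boot all_order all_algebra.

Set Implicit Arguments.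
Unset Strict Implicit.
Unset Printing Implicit Defensive.

(** A bipartite graph G = (A, B, E) has the two finite types A and B as its
    colour classes and E : {set A * B} as its edge set; the edge ab is the pair
    (a, b), and the number of vertices is n = #|A| + #|B|. *)

Definition matching (A B : finType) (M : {set A * B}) : bool :=
  [forall e in M, forall f in M, (e.1 == f.1) || (e.2 == f.2) ==> (e == f)].

Definition maximum_matching (A B : finType) (E M : {set A * B}) : Prop :=
  [/\ M \subset E, matching M &
      forall M' : {set A * B}, M' \subset E -> matching M' -> #|M'| <= #|M|].

Definition stream_of (A B : finType) (E : {set A * B}) (pi : seq (A * B)) : Prop :=
  uniq pi /\ pi =i E.

Definition greedy (A B : finType) (s : seq (A * B)) : {set A * B} :=
  foldl (fun M e => if matching (e |: M) then e |: M else M) set0 s.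

Definition degA (A B : finType) (S : {set A * B}) (a : A) : nat :=
  #|[set e in S | e.1 == a]|.

Definition degB (A B : finType) (S : {set A * B}) (b : B) : nat :=
  #|[set e in S | e.2 == b]|.

(** Meant for lam >= 1 (the subtraction is truncated). *)
Definition semi (A B : finType) (lam : nat) (s : seq (A * B)) : {set A * B} :=
  foldl (fun S e =>
           if (degA S e.1 == 0) && (degB S e.2 <= lam - 1) then e |: S else S)
        set0 s.

Definition covA (A B : finType) (F : {set A * B}) : {set A} := [set e.1 | e in F].
Definition covB (A B : finType) (F : {set A * B}) : {set B} := [set e.2 | e in F].

Definition left_wings (A B : finType) (M0 S : {set A * B}) : {set A * B} :=
  [set e in S | (e.2 \in covB M0) && (e.1 \notin covA M0)].

Definition winged (A B : finType) (M0 M1 : {set A * B}) : {set A} :=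
  [set a in covA M0 |
    [exists b, exists c, ((a, b) \in M0) && ((c, b) \in M1)]].

(** b and c give, for every edge da of M2 (the pair (a, d)), the edge ab of M0
    that is removed and the chosen edge bc of M1.  All choices are allowed. *)
Definition augmentation (A B : finType) (M0 M1 M2 M : {set A * B}) : Prop :=
  exists (b : A * B -> B) (c : A * B -> A),
    (forall e, e \in M2 -> (e.1, b e) \in M0 /\ (c e, b e) \in M1) /\
    M = (M0 :\: [set (e.1, b e) | e in M2]) :|: M2 :|: [set (c e, b e) | e in M2].

Definition two_pass_output (A B : finType) (pi : seq (A * B)) (M : {set A * B}) :
  Prop :=
  let M0 := greedy pi in
  let S := semi 3 pi in
  let M1 := left_wings M0 S in
  let A2 := winged M0 M1 in
  let F := setX A2 (~: covB M0) in
  let M2 := greedy [seq e <- pi | e \in F] in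
  augmentation M0 M1 M2 M.

(** Streaming algorithms are programs of a deterministic word RAM with [cells]
    memory cells of [bits] bits each and a write-only output tape of edges.
    Programs have no other storage: every operand is a memory cell.  Accessing
    an address >= cells, or writing a value >= 2 ^ bits, is a fault. *)

Inductive op := OpAdd | OpSub | OpEq | OpLt.

Definition eval_op (o : op) (x y : nat) : nat :=
  match o with
  | OpAdd => x + y
  | OpSub => x - y
  | OpEq => x == y
  | OpLt => x < y
  end.

Inductive cmd :=
| Skip
| Seq (c1 c2 : cmd)
| Const (i v : nat)           (* mem[i] := v *)
| Arith (o : op) (i j l : nat) (* mem[i] := mem[j] o mem[l] *)
| Fetch (i j : nat)           (* mem[i] := mem[mem[j]] *)
| Store (i j : nat)           (* mem[mem[i]] := mem[j] *)
| Emit (i j : nat)            (* output the edge (mem[i], mem[j]) *)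
| If (i : nat) (c1 c2 : cmd)  (* test mem[i] != 0 *)
| While (i : nat) (c : cmd).

Record ram := Ram { cells : nat; bits : nat }.

Record state := State { memory : nat -> nat; output : seq (nat * nat) }.

Definition rd (m : ram) (s : state) (i : nat) : option nat :=
  if i < cells m then Some (memory s i) else None.

Definition wr (m : ram) (s : state) (i v : nat) : option state :=
  if (i < cells m) && (v < 2 ^ bits m)
  then Some (State (fun j => if j == i then v else memory s j) (output s))
  else None.

(** One unit of time.  A configuration is the list of commands that remain to
    be executed, together with the state; [None] is a fault. *)
Definition step (m : ram) (cf : seq cmd * state) : option (seq cmd * state) :=
  let: (todo, s) := cf in
  match todo with
  | [::] => Some cf
  | c :: k =>
    match c with
    | Skip => Some (k, s)
    | Seq c1 c2 => Some (c1 :: c2 :: k, s)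
    | Const i v => omap (pair k) (wr m s i v)
    | Arith o i j l =>
        obind (fun x => obind (fun y =>
          omap (pair k) (wr m s i (eval_op o x y))) (rd m s l)) (rd m s j)
    | Fetch i j =>
        obind (fun a => obind (fun x =>
          omap (pair k) (wr m s i x)) (rd m s a)) (rd m s j)
    | Store i j =>
        obind (fun a => obind (fun x =>
          omap (pair k) (wr m s a x)) (rd m s j)) (rd m s i)
    | Emit i j =>
        obind (fun x => obind (fun y =>
          Some (k, State (memory s) (rcons (output s) (x, y)))) (rd m s j)) (rd m s i)
    | If i c1 c2 =>
        omap (fun x => ((if x != 0 then c1 else c2) :: k, s)) (rd m s i)
    | While i c' =>
        omap (fun x => (if x != 0 then c' :: While i c' :: k else k, s)) (rd m s i)
    end
  end.

(** The final state if [c] halts without fault within [t] steps, else [None]. *)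
Definition exec (m : ram) (t : nat) (c : cmd) (s : state) : option state :=
  if iter t (obind (step m)) (Some ([:: c], s)) is Some ([::], s') then Some s'
  else None.

(** [prologue] runs before the first pass; each pass consists of a handler run
    once per arriving edge and a handler run at the end of the pass. *)
Record stream_prog := StreamProg {
  prologue : cmd;
  passes : seq (cmd * cmd)
}.

(** Input words are delivered in cells 0 and 1. *)
Definition feed (m : ram) (s : state) (x : nat * nat) : option state :=
  obind (fun s' => wr m s' 1 x.2) (wr m s 0 x.1).

(** [te] bounds the time spent on each edge, [tb] the time of every command
    that is run before, between or after the passes. *)
Definition run_edge (m : ram) (te : nat) (c : cmd) (os : option state)
    (e : nat * nat) : option state :=
  obind (fun s => obind (exec m te c) (feed m s e)) os.

Definition run_pass (m : ram) (te tb : nat) (sigma : seq (nat * nat))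
    (os : option state) (p : cmd * cmd) : option state :=
  obind (exec m tb p.2) (foldl (run_edge m te p.1) os sigma).

(** The classes A and B are known in advance: their sizes are the first input. *)
Definition run_prog (m : ram) (te tb : nat) (P : stream_prog) (size_AB : nat * nat)
    (sigma : seq (nat * nat)) : option (seq (nat * nat)) :=
  omap output
    (foldl (run_pass m te tb sigma)
       (obind (exec m tb (prologue P)) (feed m (State (fun=> 0) [::]) size_AB))
       (passes P)).

Definition word_edge (A B : finType) (e : A * B) : nat * nat :=
  (nat_of_ord (enum_rank e.1), nat_of_ord (enum_rank e.2)).

Definition bigO (f g : nat -> nat) : Prop :=
  exists C n0, forall n, n0 <= n -> f n <= C * g n.

(** [P] is a semi-streaming algorithm with at most [k] passes and running time
    O(t) per edge which, on every stream of edges of a bipartite graph, returns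
    an edge set admitted by [spec].  Memory is counted in bits.  The work outside
    the passes is required to be linear in the number of vertices. *)
Definition semi_streaming_algorithm (k : nat) (t : nat -> nat)
    (spec : forall A B : finType, seq (A * B) -> {set A * B} -> Prop)
    (P : stream_prog) : Prop :=
  size (passes P) <= k /\
  exists (m : nat -> ram) (te tb : nat -> nat),
    [/\ exists d, bigO (fun n => cells (m n) * bits (m n))
                       (fun n => n * trunc_log 2 n ^ d),
        bigO te t,
        bigO tb id &
        forall (A B : finType) (E : {set A * B}) (pi : seq (A * B)),
          stream_of E pi ->
          let n := #|A| + #|B| in
          exists (M : {set A * B}) (o : seq (nat * nat)),
            [/\ run_prog (m n) (te n) (tb n) P (#|A|, #|B|)
                  [seq word_edge e | e <- pi] = Some o,
                perm_eq o [seq word_edge e | e <- enum M] &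
                spec A B pi M]].

(* Main.v *)
Require Import Defs.
From HB Require Import structures.
From mathcomp Require Import all_boot all_order all_algebra.
From mathcomp Require Import zify lra.

(** Write [m] for the size of a maximum matching and [k = #|M0|].  A vertex of
    [A(Mstar)] missed by [S] has an [Mstar]-partner of full degree 3 in [S], hence
    [4 #|S| >= 3 m].  As [S] has degree at most one on [A], at least [3m/4 - k] of its
    edges leave [A(M0)], so at least a third as many vertices of [A(M0)] are winged.
    All but [2k - m] vertices of [A(M0)] have their [Mstar]-partner outside [B(M0)],
    and the second greedy pass finds half of what is possible.  Together with
    [#|M| = k + #|M2| >= k] this gives [28 #|M| >= 15 m], and [15/28 > 0.519].

    For the implementation, [M0], [S] (of degree at most one on [A]), the chosen wings
    and [M2] are all stored as arrays indexed by vertices, so that an edge is handled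
    with a bounded number of array accesses, and the wings and the output are computed
    by one loop over [A] after each pass. *)

Set Implicit Arguments.
Unset Strict Implicit.
Unset Printing Implicit Defensive.

(** * Greedy matchings, semi-matchings and augmentation *)

Section Matchings.
Context (A B : finType).
Implicit Types (M S E : {set A * B}) (s pi : seq (A * B)) (a : A) (b : B).

Lemma matchingP M :
  reflect (forall e f, e \in M -> f \in M -> e.1 = f.1 \/ e.2 = f.2 -> e = f)
          (matching M).
Proof.
apply: (iffP forallP) => [H e f eM fM ef|H e].
  move: (H e); rewrite eM /= => /forallP /(_ f); rewrite fM /= => /implyP h.
  by apply/eqP/h; case: ef => ->; rewrite eqxx ?orbT.
apply/implyP => eM; apply/forallP => f; apply/implyP => fM.
by apply/implyP => /orP h; apply/eqP/H => //; case: h => /eqP; [left|right].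
Qed.

Lemma matching_inj1 M : matching M -> {in M &, injective fst}.
Proof. by move=> /matchingP mM e f eM fM h; apply: mM => //; left. Qed.

Lemma matching_inj2 M : matching M -> {in M &, injective snd}.
Proof. by move=> /matchingP mM e f eM fM h; apply: mM => //; right. Qed.

Lemma card_covA M : matching M -> #|covA M| = #|M|.
Proof. by move=> /matching_inj1; apply: card_in_imset. Qed.

Lemma card_covB M : matching M -> #|covB M| = #|M|.
Proof. by move=> /matching_inj2; apply: card_in_imset. Qed.

Lemma covAP M a : reflect (exists b, (a, b) \in M) (a \in covA M).
Proof.
apply: (iffP imsetP) => [[[a' b] h /= ->]|[b h]]; first by exists b.
by exists (a, b).
Qed.

Lemma covBP M b : reflect (exists a, (a, b) \in M) (b \in covB M).
Proof.
apply: (iffP imsetP) => [[[a b'] h /= ->]|[a h]]; first by exists a.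
by exists (a, b).
Qed.

Lemma mem_covA M e : e \in M -> e.1 \in covA M.
Proof. exact: imset_f. Qed.

Lemma mem_covB M e : e \in M -> e.2 \in covB M.
Proof. exact: imset_f. Qed.

Lemma sub_matching M M' : M \subset M' -> matching M' -> matching M.
Proof.
move=> /subsetP sub /matchingP mM; apply/matchingP => e f eM fM.
by apply: mM; apply: sub.
Qed.

Lemma matching0 : matching (set0 : {set A * B}).
Proof. by apply/matchingP => e f; rewrite inE. Qed.

Lemma matching_add M e : matching M ->
  e.1 \notin covA M -> e.2 \notin covB M -> matching (e |: M).
Proof.
move=> /matchingP mM e1 e2; apply/matchingP => f g.
rewrite !inE => /predU1P[->|fM] /predU1P[->|gM] //; last exact: mM.
- by case=> h; [case/negP: e1; rewrite h mem_covA|case/negP: e2; rewrite h mem_covB].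
- by case=> h; [case/negP: e1; rewrite -h mem_covA|case/negP: e2; rewrite -h mem_covB].
Qed.

Lemma greedy_matching s : matching (greedy s).
Proof.
rewrite /greedy; elim/last_ind: s => [|s e IH]; first exact: matching0.
by rewrite foldl_rcons; case: ifP.
Qed.

(** The matching test of [greedy] becomes a freeness test on both endpoints, which is what the
    program can check. The two tests differ only when [e] is already in the matching, and then
    adding it changes nothing. *)
Lemma greedy_rcons s e : greedy (rcons s e) =
  if (e.1 \notin covA (greedy s)) && (e.2 \notin covB (greedy s))
  then e |: greedy s else greedy s.
Proof.
rewrite {1}/greedy foldl_rcons -/(greedy s).
have mM := greedy_matching s; set M := greedy s in mM *.
case: ifP => h1; case: ifP => h2 //.
- case eM: (e \in M); first by apply/setUidPr; rewrite sub1set.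
  suff: (e.1 \notin covA M) && (e.2 \notin covB M) by rewrite h2.
  apply/andP; split; apply/negP => /imsetP[f fM ef];
    (suff ee: e = f by rewrite ee fM in eM);
    by apply: (matchingP _ h1); rewrite ?inE ?eqxx ?fM ?orbT //; auto.
- by case/andP: h2 => h2 h3; rewrite matching_add in h1.
Qed.

Lemma greedy_sub s e : e \in greedy s -> e \in s.
Proof.
elim/last_ind: s => [|s x IH]; first by rewrite inE.
rewrite greedy_rcons mem_rcons inE; case: ifP => _; last by move/IH->; rewrite orbT.
by rewrite !inE => /predU1P[->|/IH->]; rewrite ?eqxx ?orbT.
Qed.

Lemma greedy_maximal s e : e \in s ->
  (e.1 \in covA (greedy s)) || (e.2 \in covB (greedy s)).
Proof.
elim/last_ind: s => [|s x IH] //; rewrite mem_rcons inE greedy_rcons.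
set M := greedy s in IH *.
have mono : (e.1 \in covA M) || (e.2 \in covB M) ->
    (e.1 \in covA (x |: M)) || (e.2 \in covB (x |: M)).
  by move=> /orP[|] h; apply/orP; [left|right]; apply: (subsetP (imsetS _ (subsetUr _ _))) h.
case/predU1P => [->|/IH h]; case: ifP => //.
- by move=> _; rewrite mem_covA // setU11.
- by move/negbT; rewrite negb_and !negbK.
- by move=> _; apply: mono.
Qed.

(** Each edge of [M'] is charged to an endpoint covered by [M]. Since [M'] is a matching, every
    vertex is charged at most once. For a maximal matching [M] this is the factor 1/2 of greedy. *)
Lemma card_le_cov M M' : matching M' ->
  (forall e, e \in M' -> (e.1 \in covA M) || (e.2 \in covB M)) ->
  #|M'| <= #|covA M| + #|covB M|.
Proof.
move=> mM' H.
have ->: M' = [set e in M' | e.1 \in covA M] :|: [set e in M' | e.2 \in covB M].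
  by apply/setP => e; rewrite !inE -andb_orr; case eM: (e \in M') => //=; rewrite H.
apply: leq_trans (leq_card_setU _ _) _; apply: leq_add.
- rewrite -(@card_in_imset _ _ fst); last first.
    by move=> e f; rewrite !inE => /andP[eM _] /andP[fM _]; apply: matching_inj1 eM fM.
  by apply/subset_leq_card/subsetP => a /imsetP[e]; rewrite inE => /andP[_ h] ->.
- rewrite -(@card_in_imset _ _ snd); last first.
    by move=> e f; rewrite !inE => /andP[eM _] /andP[fM _]; apply: matching_inj2 eM fM.
  by apply/subset_leq_card/subsetP => a /imsetP[e]; rewrite inE => /andP[_ h] ->.
Qed.

Lemma degA_eq0 S a : (degA S a == 0) = (a \notin covA S).
Proof.
rewrite /degA cards_eq0; apply/eqP/negP => [h /covAP[b abS]|h].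
  by have := in_set0 (a, b); rewrite -h !inE abS eqxx.
by apply/setP => e; rewrite !inE; apply/negP => /andP[eS /eqP ea]; apply: h; rewrite -ea mem_covA.
Qed.

Lemma semi_rcons lam s e : semi lam (rcons s e) =
  if (e.1 \notin covA (semi lam s)) && (degB (semi lam s) e.2 <= lam - 1)
  then e |: semi lam s else semi lam s.
Proof. by rewrite {1}/semi foldl_rcons -/(semi lam s) degA_eq0. Qed.

Lemma semi_inj1 lam s : {in semi lam s &, injective fst}.
Proof.
elim/last_ind: s => [|s x IH]; first by move=> e f; rewrite inE.
rewrite semi_rcons; case: ifP => // /andP[h _] e f.
rewrite !inE => /predU1P[->|eS] /predU1P[->|fS] //; last exact: IH.
- by move=> ef; case/negP: h; rewrite ef mem_covA.
- by move=> ef; case/negP: h; rewrite -ef mem_covA.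
Qed.

Lemma semi_sub lam s e : e \in semi lam s -> e \in s.
Proof.
elim/last_ind: s => [|s x IH]; first by rewrite inE.
rewrite semi_rcons mem_rcons inE; case: ifP => _; last by move/IH->; rewrite orbT.
by rewrite !inE => /predU1P[->|/IH->]; rewrite ?eqxx ?orbT.
Qed.

Lemma degB_add S e b : e \notin S -> degB (e |: S) b = degB S b + (b == e.2).
Proof.
move=> eS; rewrite /degB.
case: (altP (b =P e.2)) => [->|ne].
  rewrite (_ : [set _ in _ | _] = e |: [set f in S | f.2 == e.2]).
    by rewrite cardsU1 inE (negbTE eS) addnC.
  by apply/setP => f; rewrite !inE; case: (altP (f =P e)) => [->|]; rewrite ?eqxx.
rewrite addn0; apply: eq_card => f; rewrite !inE.
by case: eqP => [->|_] //=; rewrite [e.2 == b]eq_sym (negbTE ne) andbF.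
Qed.

Lemma notin_covA S e : e.1 \notin covA S -> e \notin S.
Proof. by apply: contra => /mem_covA. Qed.

Lemma degB_semi_le lam s b : 0 < lam -> degB (semi lam s) b <= lam.
Proof.
move=> lam0; elim/last_ind: s => [|s x IH].
  by rewrite /degB (_ : [set _ in _ | _] = set0) ?cards0 //; apply/setP => e; rewrite !inE.
rewrite semi_rcons; case: ifP => // /andP[h1 h2].
rewrite degB_add ?notin_covA //; case: eqP => [->|_]; lia.
Qed.

(** The A-end of [e] is still uncovered at the end, so it was uncovered when [e] arrived. Hence [e]
    was refused because of its B-end, whose degree never decreases afterwards. *)
Lemma semi_saturated lam s e : e \in s -> 0 < lam ->
  e.1 \notin covA (semi lam s) -> lam <= degB (semi lam s) e.2.
Proof.
move=> + lam0; elim/last_ind: s => [|s x IH] //; rewrite mem_rcons inE semi_rcons.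
set S := semi lam s in IH *; case: ifP => h.
  case/andP: h => h1 h2 h /[dup] h3 /negP h4.
  rewrite degB_add ?notin_covA //.
  case/predU1P: h => [ex|es]; first by case: h4; rewrite ex mem_covA // setU11.
  apply: leq_trans (IH es _) (leq_addr _ _).
  by apply: contra h3; apply/subsetP/imsetS/subsetUr.
case/predU1P => [->|es]; last exact: IH.
by move=> h1; move: h; rewrite h1 /=; lia.
Qed.

Lemma sum_degB S (D : {set B}) : \sum_(b in D) degB S b <= #|S|.
Proof.
rewrite -sum1_card (partition_big (fun e => e.2) predT) //=.
rewrite [leqRHS](bigID (mem D)) /=; apply: leq_trans (leq_addr _ _).
apply: leq_sum => b _; rewrite /degB -sum1_card.
by under eq_bigl do rewrite inE.
Qed.

Lemma card_semi lam s : #|covA (semi lam s)| = #|semi lam s|.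
Proof. exact/card_in_imset/semi_inj1. Qed.

(** The edges of [M] split by whether [S] covers their A-end. The uncovered ones, [U], have distinct
    B-ends of degree at least [lam] in [S], so [lam * #|U| <= #|S|]. The others number at most
    [#|S|], because [S] covers exactly [#|S|] vertices of A. *)
Lemma semi_card lam s M : 0 < lam -> matching M -> {subset M <= s} ->
  lam * #|M| <= lam.+1 * #|semi lam s|.
Proof.
move=> lam0 mM sub; set S := semi lam s.
pose U := [set e in M | e.1 \notin covA S].
have mU : matching U by apply: sub_matching mM; apply/subsetP => e; rewrite inE => /andP[].
have hU : lam * #|U| <= #|S|.
  apply: leq_trans (sum_degB S (covB U)).
  rewrite -card_covB // -sum1_card big_distrr /=; apply: leq_sum => b.
  case/imsetP => e; rewrite inE => /andP[eM e1] ->; rewrite muln1.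
  by apply: semi_saturated => //; apply: sub.
have hC : #|M| <= #|U| + #|S|.
  rewrite -(cardsID [set e | e.1 \notin covA S] M) leq_add //.
    by rewrite (_ : M :&: _ = U) //; apply/setP => e; rewrite !inE.
  rewrite -card_semi -(@card_in_imset _ _ fst); last first.
    by move=> e f; rewrite !inE => /andP[_ eM] /andP[_ fM]; apply: matching_inj1 eM fM.
  by apply/subset_leq_card/subsetP => a /imsetP[e]; rewrite !inE negbK => /andP[h _] ->.
rewrite mulSn; apply: leq_trans (leq_add hU (leqnn _)).
by rewrite -mulnDr leq_mul2l hC orbT.
Qed.

(** The set [D] of [M0]-edges whose B-end carries a wing is in bijection both with the winged
    vertices and with [covB M1], and each vertex of [covB M1] has at most [lam] wings. *)
Lemma card_winged M0 M1 lam : matching M0 -> covB M1 \subset covB M0 ->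
  (forall b, degB M1 b <= lam) -> #|M1| <= lam * #|winged M0 M1|.
Proof.
move=> mM0 sub deg.
pose D := [set e in M0 | e.2 \in covB M1].
have sD : D \subset M0 by apply/subsetP => e; rewrite inE => /andP[].
have mD := sub_matching sD mM0.
have ->: winged M0 M1 = covA D.
  apply/setP => a; rewrite !inE; apply/andP/covAP => [[_ /existsP[b /existsP[c /andP[h1 h2]]]]|].
    by exists b; rewrite inE h1 (mem_covB h2).
  case=> b; rewrite inE => /andP[h /covBP[c cb]]; split; first exact: (mem_covA h).
  by apply/existsP; exists b; apply/existsP; exists c; rewrite h cb.
rewrite card_covA // -(card_covB mD).
have ->: covB D = covB M1.
  apply/setP => b; apply/covBP/idP => [[a]|bM1]; first by rewrite inE => /andP[].
  have /covBP[a ab] := subsetP sub _ bM1.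
  by exists a; rewrite inE ab bM1.
rewrite -sum1_card (partition_big (fun e => e.2) (mem (covB M1))) /=; last first.
  by move=> e; apply: mem_covB.
rewrite mulnC -sum_nat_const; apply: leq_sum => b _.
apply: leq_trans (deg b); rewrite /degB -sum1_card leq_eqVlt.
by apply/orP; left; apply/eqP/eq_bigl => e; rewrite inE.
Qed.

(** * Augmentation along disjoint paths of length three *)

Section Augmentation.
Context (M0 M1 M2 : {set A * B}) (mate : A * B -> B) (wing : A * B -> A).
Hypothesis mM0 : matching M0.
Hypothesis injM1 : {in M1 &, injective fst}.
Hypothesis outM1 : forall e, e \in M1 -> e.1 \notin covA M0.
Hypothesis mM2 : matching M2.
Hypothesis outM2 : forall e, e \in M2 -> e.2 \notin covB M0.
Hypothesis mateP : forall e, e \in M2 -> (e.1, mate e) \in M0.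
Hypothesis wingP : forall e, e \in M2 -> (wing e, mate e) \in M1.

Let R := [set (e.1, mate e) | e in M2].
Let L := [set (wing e, mate e) | e in M2].

Lemma mate_inj : {in M2 &, injective mate}.
Proof.
move=> e f eM fM h; apply: (matching_inj1 mM2) => //.
have /= [//] := @matching_inj2 _ mM0 _ _ (mateP eM) (mateP fM) h.
Qed.

(** Each path d-a-b-c has its ends d and c outside the vertices of [M0], and its middle edge ab
    leaves [M0]. Distinct paths have distinct mates b, and distinct c because [M1] has degree at
    most one on A. The auxiliary facts [c02], [c0L], [c2L] and [cLL] compare the kinds of edges
    pairwise. *)
Lemma augmentation_matching : matching ((M0 :\: R) :|: M2 :|: L).
Proof.
have RM e : e \in M2 -> (e.1, mate e) \in R by move=> h; apply/imsetP; exists e.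
have c02 x y : x \in M0 :\: R -> y \in M2 -> x.1 = y.1 \/ x.2 = y.2 -> False.
  rewrite inE => /andP[xR xM] yM [h|h]; last by move: (outM2 yM); rewrite -h mem_covB.
  have xy := matching_inj1 mM0 xM (mateP yM) h.
  by rewrite xy RM in xR.
have c0L x y : x \in M0 :\: R -> y \in L -> x.1 = y.1 \/ x.2 = y.2 -> False.
  rewrite inE => /andP[xR xM] /imsetP[e eM ->] /= [h|h].
    by move: (outM1 (wingP eM)); rewrite /= -h mem_covA.
  have xy := matching_inj2 mM0 xM (mateP eM) h.
  by rewrite xy RM in xR.
have c2L x y : x \in M2 -> y \in L -> x.1 = y.1 \/ x.2 = y.2 -> False.
  move=> xM /imsetP[e eM ->] /= [h|h].
    by move: (outM1 (wingP eM)); rewrite /= -h (mem_covA (mateP xM)).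
  by move: (outM2 xM); rewrite h (mem_covB (mateP eM)).
have cLL x y : x \in L -> y \in L -> x.1 = y.1 \/ x.2 = y.2 -> x = y.
  move=> /imsetP[e eM ->] /imsetP[f fM ->] /= [h|h].
    exact: (injM1 (wingP eM) (wingP fM)).
  by rewrite (mate_inj eM fM h).
have sw (x y : A * B) : x.1 = y.1 \/ x.2 = y.2 -> y.1 = x.1 \/ y.2 = x.2.
  by case=> ->; auto.
apply/matchingP => x y; rewrite [x \in _]inE [x \in _ :|: M2]inE [y \in _]inE [y \in _ :|: M2]inE.
move=> /orP[/orP[]|] hx /orP[/orP[]|] hy hxy.
- move: hx hy; rewrite !inE => /andP[_ hx] /andP[_ hy]; exact: (matchingP _ mM0).
- by case: (c02 _ _ hx hy).
- by case: (c0L _ _ hx hy).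
- by case: (c02 _ _ hy hx); apply: sw.
- exact: (matchingP _ mM2).
- by case: (c2L _ _ hx hy).
- by case: (c0L _ _ hy hx); apply: sw.
- by case: (c2L _ _ hy hx); apply: sw.
- exact: cLL.
Qed.

Lemma augmentation_card : #|(M0 :\: R) :|: M2 :|: L| = #|M0| + #|M2|.
Proof.
have sR : R \subset M0 by apply/subsetP => x /imsetP[e eM ->]; apply: mateP.
have cR : #|R| = #|M2|.
  by apply: card_in_imset => e f eM fM [h _]; apply: (matching_inj1 mM2).
have cL : #|L| = #|M2|.
  by apply: card_in_imset => e f eM fM [_ h]; apply: mate_inj.
have d02 : [disjoint M0 :\: R & M2].
  rewrite -setI_eq0; apply/eqP/setP => x; rewrite !inE; apply/negP => /andP[/andP[_ h0] h2].
  by move: (outM2 h2); rewrite mem_covB.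
have dL : [disjoint (M0 :\: R) :|: M2 & L].
  rewrite -setI_eq0; apply/eqP/setP => x; rewrite !inE.
  apply/negP => /andP[/orP[/andP[_ h0]|h2] /imsetP[e eM xe]].
    by move: (outM1 (wingP eM)); rewrite -xe mem_covA.
  by move: (outM2 h2); rewrite xe (mem_covB (mateP eM)).
rewrite cardsU disjoint_setI0 // cards0 subn0 cL.
rewrite cardsU disjoint_setI0 // cards0 subn0 cardsD (setIidPr sR) cR.
by rewrite subnK // -cR subset_leq_card.
Qed.

End Augmentation.


(** * Correctness and approximation ratio of the two-pass algorithm *)

Lemma left_wings_props pi : let M0 := greedy pi in
  let M1 := left_wings M0 (semi 3 pi) in
  [/\ {in M1 &, injective fst}, forall e, e \in M1 -> e.1 \notin covA M0,
      covB M1 \subset covB M0 & forall b, degB M1 b <= 3].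
Proof.
move=> M0 M1; have sub e : e \in M1 -> e \in semi 3 pi by rewrite inE => /andP[].
split.
- by move=> e f /sub eS /sub fS; apply: semi_inj1 eS fS.
- by move=> e; rewrite inE => /and3P[].
- by apply/subsetP => b /imsetP[e]; rewrite inE => /and3P[_ h _] ->.
- move=> b; apply: leq_trans (degB_semi_le pi b (isT : 0 < 3)).
  apply: subset_leq_card; apply/subsetP => e; rewrite !inE -!andbA.
  by move=> /and4P[-> _ _ ->].
Qed.

Lemma mem_greedy_filter pi (F : {set A * B}) e :
  e \in greedy [seq e <- pi | e \in F] -> e \in F /\ e \in pi.
Proof. by move/greedy_sub; rewrite mem_filter => /andP. Qed.

Lemma two_pass_correct E pi M : stream_of E pi -> two_pass_output pi M ->
  [/\ M \subset E, matching M &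
    #|M| = #|greedy pi| + #|greedy [seq e <- pi | e \in
      setX (winged (greedy pi) (left_wings (greedy pi) (semi 3 pi)))
           (~: covB (greedy pi))]|].
Proof.
move=> [_ piE]; rewrite /two_pass_output /=.
set M0 := greedy pi; set M1 := left_wings _ _; set F := setX _ _; set M2 := greedy _.
case=> b [c [H ->]].
have [inj1 out1 _ _] := left_wings_props pi.
have H1 e : e \in M2 -> (e.1, b e) \in M0 by case/H.
have H2 e : e \in M2 -> (c e, b e) \in M1 by case/H.
have out2 e : e \in M2 -> e.2 \notin covB M0.
  by case/mem_greedy_filter; rewrite !inE => /andP[].
have m0 := greedy_matching pi.
have m2 : matching M2 by apply: greedy_matching.
split; [|exact: (augmentation_matching m0 inj1 out1 m2 out2 H1 H2)
  |exact: (augmentation_card m0 out1 m2 out2 H1 H2)].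
apply/subsetP => e; rewrite -piE !inE => /orP[/orP[/andP[_]|]|].
- exact: greedy_sub.
- by case/mem_greedy_filter.
- by case/imsetP => f /H2; rewrite inE => /andP[/semi_sub + _] => + ->.
Qed.

Lemma two_pass_ratio E Mstar pi M : maximum_matching E Mstar ->
  stream_of E pi -> two_pass_output pi M -> 15 * #|Mstar| <= 28 * #|M|.
Proof.
move=> [sE mstar _] st out; have [_ _ ->] := two_pass_correct st out.
set M0 := greedy pi; set M1 := left_wings _ _; set A2 := winged _ _.
set F := setX _ _; set M2 := greedy _.
have [_ piE] := st.
have sub : {subset Mstar <= pi} by move=> e /(subsetP sE); rewrite piE.
have [inj1 out1 cov1 deg1] := left_wings_props pi.
have m0 : matching M0 by apply: greedy_matching.
have m2 : matching M2 by apply: greedy_matching.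
have hS := semi_card (isT : 0 < 3) mstar sub.
have hA2 : #|M1| <= 3 * #|A2| by apply: card_winged.
(* By maximality of [M0], an edge of [S] whose A-end is free has its B-end matched, so it is a left
   wing. The other edges of [S] have distinct A-ends in [covA M0]. *)
have hM1 : #|semi 3 pi| <= #|M1| + #|M0|.
  rewrite -card_semi -(card_in_imset inj1) -(card_covA m0).
  apply: leq_trans (leq_card_setU _ _); apply/subset_leq_card/subsetP => a.
  case/imsetP => e eS ->; rewrite inE.
  case e1: (e.1 \in covA M0); first by rewrite orbT.
  rewrite orbF; apply: imset_f; rewrite inE eS e1 /=.
  by have := greedy_maximal (semi_sub eS); rewrite -/M0 e1 /= => ->.
(* [X] consists of the optimal edges with a free B-end; [Y] consists of those among them that the
   second pass may take, because their A-end is winged. *)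
pose X := [set e in Mstar | e.2 \notin covB M0].
pose Y := [set e in X | e.1 \in A2].
have sX : X \subset Mstar by apply/subsetP => e; rewrite inE => /andP[].
have sY : Y \subset X by apply/subsetP => e; rewrite inE => /andP[].
have mX := sub_matching sX mstar.
have hX : #|Mstar| <= #|X| + #|M0|.
  rewrite -(cardsID X Mstar) (setIidPr sX) leq_add2l -(card_covB m0).
  rewrite -(@card_in_imset _ _ snd); last first.
    by move=> e f; rewrite !inE => /andP[_ eM] /andP[_ fM]; apply: matching_inj2 eM fM.
  apply/subset_leq_card/subsetP => b /imsetP[e + ->].
  by rewrite !inE => /andP[h1 h2]; move: h1; rewrite h2 negbK.
(* Inclusion-exclusion inside [covA M0]: it contains [A2], and it contains [covA X] by maximality of
   [M0]. *)
have hY : #|X| + #|A2| <= #|Y| + #|M0|.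
  have -> : #|Y| = #|covA X :&: A2|.
    rewrite -(card_covA (sub_matching sY mX)); apply: eq_card => a.
    rewrite inE; apply/covAP/andP => [[b]|[/covAP[b ab] aA]].
      by rewrite inE => /andP[ab ?]; split => //; apply: (mem_covA ab).
    by exists b; rewrite inE ab.
  rewrite -(card_covA mX) -cardsUI addnC leq_add2l -(card_covA m0).
  apply/subset_leq_card/subsetP => a; rewrite inE => /orP[/imsetP[e eX ->]|].
    move: eX; rewrite inE => /andP[eM h].
    by have := greedy_maximal (sub _ eM); rewrite -/M0 (negbTE h) orbF.
  by rewrite inE => /andP[].
have hM2 : #|Y| <= #|M2| + #|M2|.
  rewrite -{1}(card_covA m2) -(card_covB m2).
  apply: card_le_cov; first exact: sub_matching sY mX.
  move=> e; rewrite inE => /andP[eX eA]; apply: greedy_maximal.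
  move: eX; rewrite inE => /andP[eM h].
  by rewrite mem_filter sub // andbT inE eA in_setC.
(* With m and k the sizes of [Mstar] and [M0], the bounds give [#|M2|] at least 5m/8 - 7k/6, so k +
   [#|M2|] is at least 5m/8 - k/6. It is also at least k; weighting these two bounds by 6/7 and 1/7
   eliminates k and leaves 15m/28. *)
lia.
Qed.

End Matchings.

(** * A structured language compiled to the word RAM *)

(* Registers are the cells 0 .. 13.  Every index i below n carries eight fields;
   field f of index i is the cell 16 + 8 i + f, and cells 14 and 15 are scratch
   space for computing such an address.  [SLoad f r i] sets register r to field f
   of the index held in register i; [SStore f i r] is the converse. *)
Inductive scmd :=
| SSkip
| SSeq (c1 c2 : scmd)
| SConst (r v : nat)
| SArith (o : op) (r j l : nat)
| SLoad (f r i : nat)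
| SStore (f i r : nat)
| SEmit (i j : nat)
| SIf (i : nat) (c1 c2 : scmd)
| SWhile (i : nat) (c : scmd).

Definition field_addr (f i : nat) : cmd :=
  Seq (Arith OpAdd 14 i i) (Seq (Arith OpAdd 14 14 14) (Seq (Arith OpAdd 14 14 14)
    (Seq (Const 15 (16 + f)) (Arith OpAdd 14 14 15)))).

Fixpoint compile (c : scmd) : cmd :=
  match c with
  | SSkip => Skip
  | SSeq c1 c2 => Seq (compile c1) (compile c2)
  | SConst r v => Const r v
  | SArith o r j l => Arith o r j l
  | SLoad f r i => Seq (field_addr f i) (Fetch r 14)
  | SStore f i r => Seq (field_addr f i) (Store 14 r)
  | SEmit i j => Emit i j
  | SIf i c1 c2 => If i (compile c1) (compile c2)
  | SWhile i c => While i (compile c)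
  end.

Record sstate := SState {
  reg : nat -> nat;
  fld : nat -> nat -> nat;
  out : seq (nat * nat)
}.

Definition setr (st : sstate) (r v : nat) : sstate :=
  SState (fun j => if j == r then v else reg st j) (fld st) (out st).

Definition setf (st : sstate) (f i v : nat) : sstate :=
  SState (reg st)
    (fun g j => if g == f then (if j == i then v else fld st g j) else fld st g j)
    (out st).

Definition emit (st : sstate) (e : nat * nat) : sstate :=
  SState (reg st) (fld st) (rcons (out st) e).

(** Registers stay below 14 so that the scratch cells are never touched directly, and constants stay
    below 16 so that they fit in a word for every [n]. *)
Fixpoint wf (c : scmd) : bool :=
  match c with
  | SSkip => true
  | SSeq c1 c2 => wf c1 && wf c2
  | SConst r v => (r < 14) && (v < 16)
  | SArith _ r j l => [&& r < 14, j < 14 & l < 14]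
  | SLoad f r i => [&& f < 8, r < 14 & i < 14]
  | SStore f i r => [&& f < 8, r < 14 & i < 14]
  | SEmit i j => (i < 14) && (j < 14)
  | SIf i c1 c2 => [&& i < 14, wf c1 & wf c2]
  | SWhile i c => (i < 14) && wf c
  end.

(** A field access takes 9 steps for the address, one for the access and one for the enclosing
    [Seq]. The value on loops is a dummy, since [wp] rejects them. *)
Fixpoint cost (c : scmd) : nat :=
  match c with
  | SSeq c1 c2 => (cost c1 + cost c2).+1
  | SLoad _ _ _ | SStore _ _ _ => 11
  | SIf _ c1 c2 => (maxn (cost c1) (cost c2)).+1
  | _ => 1
  end.

(* Loops are handled by [triple_while]. *)
Fixpoint wp (n W : nat) (c : scmd) (Q : sstate -> Prop) (st : sstate) : Prop :=
  match c with
  | SSkip => Q st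
  | SSeq c1 c2 => wp n W c1 (wp n W c2 Q) st
  | SConst r v => Q (setr st r v)
  | SArith o r j l =>
      (if o is OpAdd then reg st j + reg st l < W else true) /\
      Q (setr st r (eval_op o (reg st j) (reg st l)))
  | SLoad f r i => reg st i < n /\ Q (setr st r (fld st f (reg st i)))
  | SStore f i r => reg st i < n /\ Q (setf st f (reg st i) (reg st r))
  | SEmit i j => Q (emit st (reg st i, reg st j))
  | SIf i c1 c2 => if reg st i != 0 then wp n W c1 Q st else wp n W c2 Q st
  | SWhile _ _ => False
  end.

Lemma wp_mono n W c (Q Q' : sstate -> Prop) st :
  (forall st, Q st -> Q' st) -> wp n W c Q st -> wp n W c Q' st.
Proof.
elim: c Q Q' st => //=; try by move=> *; intuition.
- by move=> c1 IH1 c2 IH2 Q Q' st H; apply: IH1 => st'; apply: IH2.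
- by move=> i c1 IH1 c2 IH2 Q Q' st H; case: ifP => _; [apply: IH1|apply: IH2].
Qed.

(** * Simulation on the word RAM and timed Hoare triples *)

Section Machine.
Context (n : nat) (m : ram).
Hypothesis cellsE : cells m = 16 + 8 * n.
Hypothesis bitsE : cells m <= 2 ^ bits m.
Notation W := (2 ^ bits m).

(** The scratch cells 14 and 15 are constrained only by the word bound. That bound is imposed on all
    cells, so that any value read can be written back without a fault. *)
Definition represents (s : state) (st : sstate) : Prop :=
  [/\ forall i, memory s i < W,
      forall r, r < 14 -> memory s r = reg st r,
      forall f i, f < 8 -> i < n -> memory s (16 + 8 * i + f) = fld st f i &
      output s = out st].

(** Quantifying over the continuation [k] makes executions compose by adding their step counts. *)
Definition runs (c : cmd) (t : nat) (s s' : state) : Prop :=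
  forall k, iter t (obind (step m)) (Some (c :: k, s)) = Some (k, s').

Lemma runs_seq c1 c2 t1 t2 s s1 s2 : runs c1 t1 s s1 -> runs c2 t2 s1 s2 ->
  runs (Seq c1 c2) (t1 + t2).+1 s s2.
Proof. by move=> h1 h2 k; rewrite iterSr /= addnC iterD h1 h2. Qed.

Definition setm (s : state) (i v : nat) : state :=
  State (fun j => if j == i then v else memory s j) (output s).

Lemma wrE s i v : i < cells m -> v < W -> wr m s i v = Some (setm s i v).
Proof. by rewrite /wr => -> ->. Qed.

Lemma rdE s i : i < cells m -> rd m s i = Some (memory s i).
Proof. by rewrite /rd => ->. Qed.

Lemma runs_const s i v : i < cells m -> v < W -> runs (Const i v) 1 s (setm s i v).
Proof. by move=> hi hv k; rewrite /= wrE. Qed.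

Lemma runs_arith s o i j l : i < cells m -> j < cells m -> l < cells m ->
  eval_op o (memory s j) (memory s l) < W ->
  runs (Arith o i j l) 1 s (setm s i (eval_op o (memory s j) (memory s l))).
Proof. by move=> hi hj hl hv k; rewrite /= !rdE //= wrE. Qed.

Lemma repr_temp s st i v : represents s st -> 14 <= i < 16 -> v < W ->
  represents (setm s i v) st.
Proof.
move=> [h1 h2 h3 h4] hi hv; split => //=.
- by move=> j; case: eqP.
- by move=> r hr; rewrite -h2 // ifN //; lia.
- by move=> f j hf hj; rewrite -h3 // ifN //; lia.
Qed.

Lemma repr_setr s st i v : represents s st -> i < 14 -> v < W ->
  represents (setm s i v) (setr st i v).
Proof.
move=> [h1 h2 h3 h4] hi hv; split => //=.
- by move=> j; case: eqP.
- by move=> r hr; rewrite -h2.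
- by move=> f j hf hj; rewrite -h3 // ifN //; lia.
Qed.

Lemma repr_setf s st f i v : represents s st -> f < 8 -> i < n -> v < W ->
  represents (setm s (16 + 8 * i + f) v) (setf st f i v).
Proof.
move=> [h1 h2 h3 h4] hf hi hv; split => //=.
- by move=> j; case: eqP.
- by move=> r hr; rewrite -h2 // ifN //; lia.
- move=> g j hg hj; rewrite -h3 //.
  case: (altP (g =P f)) => [->|ne].
    by case: (altP (j =P i)) => [->|ne]; rewrite ?eqxx // ifN //; lia.
  by rewrite ifN //; lia.
Qed.

Lemma runs_field_addr s st f i : represents s st -> f < 8 -> i < 14 -> reg st i < n ->
  exists s', [/\ runs (field_addr f i) 9 s s', represents s' st &
                 memory s' 14 = 16 + 8 * reg st i + f].
Proof.
move=> h hf hi hn; have [h1 h2 h3 h4] := h.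
have ei := h2 _ hi.
have hc : 16 + 8 * n <= W by rewrite -cellsE.
have d0 : 14 < cells m by lia.
have d1 : 15 < cells m by lia.
have d2 : i < cells m by lia.
eexists; split.
- apply: (@runs_seq _ _ 1 7).
    by apply: runs_arith => //=; rewrite ei; lia.
  apply: (@runs_seq _ _ 1 5).
    by apply: runs_arith => //=; rewrite ei; lia.
  apply: (@runs_seq _ _ 1 3).
    by apply: runs_arith => //=; rewrite ei; lia.
  apply: (@runs_seq _ _ 1 1).
    by apply: runs_const => //=; lia.
  by apply: runs_arith => //=; rewrite ei; lia.
- by do 5! (apply: repr_temp; [|by []|by rewrite /= ?ei; lia]).
- by rewrite /= ei; lia.
Qed.

Definition triple (P : sstate -> Prop) (c : scmd) (T : nat) (Q : sstate -> Prop) :=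
  forall s st, represents s st -> P st ->
  exists t s' st', [/\ t <= T, runs (compile c) t s s', represents s' st' & Q st'].

Lemma triple_seq P Q R c1 c2 T1 T2 :
  triple P c1 T1 Q -> triple Q c2 T2 R -> triple P (SSeq c1 c2) (T1 + T2).+1 R.
Proof.
move=> H1 H2 s st /H1{}H1 /H1[t1 [s1 [st1 [ht1 hr1 /H2{}H2 /H2]]]].
case=> t2 [s2 [st2 [ht2 hr2 h q]]].
exists (t1 + t2).+1, s2, st2; split => //; first by rewrite ltnS leq_add.
exact: runs_seq hr1 hr2.
Qed.

(** The invariant is indexed by the value of the loop register, which is therefore the number of
    remaining iterations. Each iteration pays one step for its test, and one more step pays for the
    final failing test. *)
Lemma triple_while i c T (I : nat -> sstate -> Prop) : i < 14 ->
  (forall j st, I j st -> reg st i = j) ->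
  (forall j, triple (I j.+1) c T (I j)) ->
  forall j, triple (I j) (SWhile i c) (j * T.+1).+1 (I 0).
Proof.
move=> hi Ir H; have hi' : i < cells m by lia.
elim=> [|j IH] s st h hI.
  exists 1, s, st; split => // k; rewrite /= rdE //=.
  by case: h => [_ -> // _ _]; rewrite (Ir _ _ hI).
have [t1 [s1 [st1 [ht1 hr1 h1 hI1]]]] := H _ _ _ h hI.
have [t2 [s2 [st2 [ht2 hr2 h2 hI2]]]] := IH _ _ h1 hI1.
exists (t1 + t2).+1, s2, st2; split => //; first by rewrite mulSn; lia.
move=> k; rewrite iterSr /= rdE //=.
have -> : memory s i != 0 by case: h => [_ -> // _ _]; rewrite (Ir _ _ hI).
by rewrite addnC iterD hr1 hr2.
Qed.

Lemma triple_wp c (Q P : sstate -> Prop) : wf c ->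
  (forall st, P st -> wp n W c Q st) -> triple P c (cost c) Q.
Proof.
have hc : 16 + 8 * n <= W by rewrite -cellsE.
have dm i : i < 14 -> i < cells m by lia.
move=> wfc H s st h /H {P H}.
elim: c s st h wfc Q => /=.
- by move=> s st h _ Q q; exists 1, s, st; split.
- move=> c1 IH1 c2 IH2 s st h /andP[w1 w2] Q /(IH1 _ _ h w1).
  case=> t1 [s1 [st1 [ht1 hr1 h1 /(IH2 _ _ h1 w2)]]].
  case=> t2 [s2 [st2 [ht2 hr2 h2 q]]].
  exists (t1 + t2).+1, s2, st2; split => //; first by lia.
  exact: runs_seq hr1 hr2.
- move=> r v s st h /andP[hr hv] Q q; have hv' : v < W by lia.
  exists 1, (setm s r v), (setr st r v); split => //; last exact: repr_setr.
  by apply: runs_const => //; apply: dm.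
- move=> o r j l s st h /and3P[hr hj hl] Q [ho q].
  have [h1 h2 _ _] := h.
  (* Only addition can overflow: a truncated difference is at most its first argument, and a
     comparison yields 0 or 1. *)
  have ov : eval_op o (reg st j) (reg st l) < W.
    have := h1 j; have := h1 l; rewrite !h2 //.
    by case: o ho {q} => //= _; lia.
  exists 1; eexists; eexists; split; [by []| |exact: (repr_setr h hr ov)|exact: q].
  by rewrite -!h2 //; apply: runs_arith; rewrite ?h2 //; apply: dm.
- move=> f r i s st h /and3P[hf hr hi] Q [hin q].
  have [s1 [hr1 h1 e1]] := runs_field_addr h hf hi hin.
  have [g1 g2 g3 _] := h1.
  have e2 : memory s1 (16 + 8 * reg st i + f) = fld st f (reg st i) by apply: g3.
  exists 11, (setm s1 r (fld st f (reg st i))); eexists; split; [by []| | |exact: q].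
    apply: (@runs_seq _ _ 9 1) hr1 _ => k /=.
    rewrite rdE /=; last by lia.
    rewrite e1 rdE /=; last by lia.
    by rewrite e2 wrE //; [lia|rewrite -e2].
  by apply: repr_setr => //; rewrite -e2.
- move=> f i r s st h /and3P[hf hr hi] Q [hin q].
  have [s1 [hr1 h1 e1]] := runs_field_addr h hf hi hin.
  have [g1 g2 g3 _] := h1.
  have vW : reg st r < W by rewrite -g2.
  exists 11; eexists; eexists; split; [by []| |exact: (repr_setf h1 hf hin vW)|exact: q].
  apply: (@runs_seq _ _ 9 1) hr1 _ => k /=.
  rewrite (@rdE s1 14) /=; last by lia.
  rewrite e1 rdE /=; last by lia.
  by rewrite g2 // wrE //; lia.
- move=> i j s st h /andP[hi hj] Q q; have [h1 h2 h3 h4] := h.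
  exists 1, (State (memory s) (rcons (output s) (memory s i, memory s j))).
  exists (emit st (reg st i, reg st j)); split => //.
    by move=> k; rewrite /= !rdE //; apply: dm.
  by split => //=; rewrite h4 !h2.
- move=> i c1 IH1 c2 IH2 s st h /and3P[hi w1 w2] Q hwp.
  have ei : memory s i = reg st i by case: h => _ -> //.
  move: hwp; case: ifP => b => [/(IH1 _ _ h w1)|/(IH2 _ _ h w2)];
  case=> t1 [s1 [st1 [ht1 hr1 h1 q]]]; exists t1.+1, s1, st1; split => //;
    try (by lia); move=> k; rewrite iterSr /= (rdE _ (dm _ hi)) /= ei b; apply: hr1.
- by [].
Qed.

Lemma triple_le P Q c T T' : T <= T' -> triple P c T Q -> triple P c T' Q.
Proof.
move=> le H s st h p; have [t [s' [st' [ht ? ? ?]]]] := H s st h p.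
by exists t, s', st'; split => //; apply: leq_trans le.
Qed.

Lemma exec_triple P Q c T s st : triple P c T Q -> represents s st -> P st ->
  exists s' st', [/\ exec m T (compile c) s = Some s', represents s' st' & Q st'].
Proof.
move=> H h /(H _ _ h)[t [s' [st' [tT hr h' q]]]]; exists s', st'; split => //.
rewrite /exec -(subnK tT) iterD hr.
suff -> : iter (T - t) (obind (step m)) (Some ([::], s')) = Some ([::], s') by [].
by elim: (T - t) => //= d ->.
Qed.

Lemma feed_represents s st e : represents s st -> e.1 < W -> e.2 < W ->
  exists2 s', feed m s e = Some s' & represents s' (setr (setr st 0 e.1) 1 e.2).
Proof.
move=> h h1 h2; have d0 : 1 < cells m by lia.
exists (setm (setm s 0 e.1) 1 e.2); last by do 2! apply: repr_setr => //.
by rewrite /feed wrE /= ?wrE // ltnW.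
Qed.

(** Induction on the prefix of the stream already read, which indexes the invariant [I]; each
    arrival first overwrites registers 0 and 1. *)
Lemma run_pass_triple (T : Type) (word : T -> nat * nat) (sigma : seq T) (te tb : nat)
    (c d : scmd) (I : seq T -> sstate -> Prop) (Q : sstate -> Prop) s st :
  (forall x, (word x).1 < W /\ (word x).2 < W) ->
  (forall sg x, triple (fun st => exists2 st0, I sg st0 &
        st = setr (setr st0 0 (word x).1) 1 (word x).2) c te (I (rcons sg x))) ->
  triple (I sigma) d tb Q ->
  represents s st -> I [::] st ->
  exists s' st', [/\ run_pass m te tb (map word sigma) (Some s) (compile c, compile d)
                       = Some s', represents s' st' & Q st'].
Proof.
move=> hW hc hd h hI.
have [s1 [st1 [e1 h1 I1]]] : exists s' st',
    [/\ foldl (run_edge m te (compile c)) (Some s) (map word sigma) = Some s',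
        represents s' st' & I sigma st'].
  elim/last_ind: sigma {hd} => [|sg x [s1 [st1 [e1 h1 I1]]]]; first by exists s, st.
  rewrite map_rcons foldl_rcons e1 /=.
  have [w1 w2] := hW x; have [s2 -> h2] := feed_represents h1 w1 w2.
  by apply: exec_triple (hc sg x) h2 _; exists st1.
by rewrite /run_pass /= e1 /=; apply: exec_triple hd h1 I1.
Qed.

End Machine.

(** * The two-pass program *)

Declare Scope scmd_scope.
Notation "c1 ;; c2" := (SSeq c1 c2) (at level 60, right associativity) : scmd_scope.
Local Open Scope scmd_scope.

(* Vertices are identified with their ranks, and [A] and [B] share the index range.
   Field 0 of a: 1 + its partner in M0, or 0.    Field 1 of b: whether b is in B(M0).
   Field 2 of a: 1 + its partner in S, or 0.     Field 3 of b: its degree in S.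
   Field 4 of b: 1 + some c with bc in M1, or 0.
   Fields 5 and 6 play the roles of fields 0 and 1 for M2.
   Register 2 keeps #|A|. *)
Definition prologue_code : scmd := SConst 4 0;; SArith OpAdd 2 0 4.

Definition greedy_step (fa fb : nat) : scmd :=
  SLoad fa 3 0;;
  SIf 3 SSkip
    (SLoad fb 3 1;;
     SIf 3 SSkip
       (SConst 4 1;; SArith OpAdd 5 1 4;; SStore fa 0 5;; SStore fb 1 4)).

Definition semi_step : scmd :=
  SLoad 2 3 0;;
  SIf 3 SSkip
    (SLoad 3 3 1;; SConst 4 3;; SArith OpLt 5 3 4;;
     SIf 5
       (SConst 4 1;; SArith OpAdd 5 1 4;; SStore 2 0 5;;
        SArith OpAdd 5 3 4;; SStore 3 1 5)
       SSkip).

(** Counting down lets register 8 serve both as loop test and, once decremented, as the rank of the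
    current vertex. Register 4 holds 1 when [body] starts; the bodies use it to convert between
    ranks and codes. *)
Definition for_each_A (body : scmd) : scmd :=
  (SConst 4 0;; SArith OpAdd 8 2 4);;
  SWhile 8 (SConst 4 1;; SArith OpSub 8 8 4;; body).

Definition wing_body : scmd :=
  SLoad 2 3 8;;
  SIf 3
    (SLoad 0 5 8;;
     SIf 5 SSkip
       (SArith OpSub 3 3 4;; SLoad 1 5 3;;
        SIf 5 (SArith OpAdd 5 8 4;; SStore 4 3 5) SSkip))
    SSkip.

(** The pairs of [F] are never stored: membership is decided by following the [M0]-edge at the A-end
    of the arriving edge and looking for a recorded wing at its mate. *)
Definition second_step : scmd :=
  SLoad 1 3 1;;
  SIf 3 SSkip
    (SLoad 0 4 0;;
     SIf 4
       (SConst 5 1;; SArith OpSub 4 4 5;; SLoad 4 5 4;;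
        SIf 5 (greedy_step 5 6) SSkip)
       SSkip).

Definition output_body : scmd :=
  SLoad 0 3 8;;
  SIf 3
    (SArith OpSub 3 3 4;; SLoad 5 5 8;;
     SIf 5
       (SArith OpSub 5 5 4;; SEmit 8 5;; SLoad 4 5 3;; SArith OpSub 5 5 4;; SEmit 5 3)
       (SEmit 8 3))
    SSkip.

Definition two_pass_prog : stream_prog :=
  StreamProg (compile prologue_code)
    [:: (compile (greedy_step 0 1;; semi_step), compile (for_each_A wing_body));
        (compile second_step, compile (for_each_A output_body))].

Definition rk (T : finType) (x : T) : nat := enum_rank x.

Definition code (T : finType) (o : option T) : nat :=
  if o is Some x then (rk x).+1 else 0.

Lemma rk_eq (T : finType) (x y : T) : (rk x == rk y) = (x == y).
Proof. by rewrite /rk (inj_eq val_inj) (inj_eq enum_rank_inj). Qed.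

Lemma rk_lt (T : finType) (x : T) : rk x < #|T|.
Proof. exact: ltn_ord. Qed.

(** * Matchings and semi-matchings as partner arrays *)

Section Partner.
Context (A B : finType).
Implicit Types (M : {set A * B}) (a : A) (b : B).

Definition partner M a : option B := [pick b | (a, b) \in M].

Lemma partner_some M a b : partner M a = Some b -> (a, b) \in M.
Proof. by rewrite /partner; case: pickP => // b' h [<-]. Qed.

Lemma code_partner0 M a : (code (partner M a) == 0) = (a \notin covA M).
Proof.
rewrite /partner; case: pickP => [b ab|h] /=.
  by apply/esym/negbTE; rewrite negbK; apply/covAP; exists b.
by apply/esym/negP => /covAP[b]; rewrite h.
Qed.

Lemma partner_none M a : (partner M a == None) = (a \notin covA M).
Proof. by rewrite -code_partner0; case: partner. Qed.

Lemma partner_in M a b : {in M &, injective fst} -> (a, b) \in M ->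
  partner M a = Some b.
Proof.
move=> inj ab; case e: (partner M a) => [b'|].
  by have [->] := inj _ _ ab (partner_some e) erefl.
by move/eqP: e; rewrite partner_none => /negP[]; apply: (mem_covA ab).
Qed.

Lemma partner_add M e a : e.1 \notin covA M ->
  partner (e |: M) a = if a == e.1 then Some e.2 else partner M a.
Proof.
move=> h; case: eqP => [->|ne].
  rewrite /partner; case: pickP => [b|/(_ e.2)]; last by rewrite -surjective_pairing setU11.
  rewrite !inE => /predU1P[<- //|eM].
  by case/negP: h; apply: (mem_covA eM).
by apply: eq_pick => b; rewrite !inE; case: eqP => // ee; case: ne; rewrite -ee.
Qed.

Lemma covB_add M e b : (b \in covB (e |: M)) = (b == e.2) || (b \in covB M).
Proof. by rewrite /covB imsetU1 !inE. Qed.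

End Partner.

(** * Invariants of the handlers and loops *)

Section Program.
Context (A B : finType) (W : nat).
Notation n := (#|A| + #|B|).
Hypothesis hW : 16 + 8 * n <= W.
Implicit Types (M : {set A * B}) (a : A) (b : B) (st : sstate) (w : B -> option A).

Lemma rkA_lt a : rk a < n.
Proof. exact: leq_trans (rk_lt a) (leq_addr _ _). Qed.

Lemma rkB_lt b : rk b < n.
Proof. exact: leq_trans (rk_lt b) (leq_addl _ _). Qed.

Definition stored (fa fb : nat) M st : Prop :=
  (forall a, fld st fa (rk a) = code (partner M a)) /\
  (forall b, fld st fb (rk b) = (b \in covB M)).

Definition greedy_add M (e : A * B) : {set A * B} :=
  if (e.1 \notin covA M) && (e.2 \notin covB M) then e |: M else M.

(** The fields are parameters because the same code builds [M0] in fields 0 and 1 and [M2] in fields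
    5 and 6. The premise on [Q] carries the frame: low registers, output and all other fields are
    unchanged. *)
Lemma wp_greedy_step (fa fb : nat) M (e : A * B) (Q : sstate -> Prop) st :
  fa != fb -> reg st 0 = rk e.1 -> reg st 1 = rk e.2 -> stored fa fb M st ->
  (forall st', (forall r, r < 3 -> reg st' r = reg st r) -> out st' = out st ->
     (forall f i, f != fa -> f != fb -> fld st' f i = fld st f i) ->
     stored fa fb (greedy_add M e) st' -> Q st') ->
  wp n W (greedy_step fa fb) Q st.
Proof.
move=> ab h0 h1 [hA hB] H; rewrite /= h0 h1; split; first exact: rkA_lt.
rewrite hA code_partner0 negbK; case: ifP => eA.
  apply: H => //=; first by case=> [|[|[|]]].
  by rewrite /greedy_add eA.
rewrite ?h1; split; first exact: rkB_lt.
rewrite hB eqb0 negbK; case: ifP => eB.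
  apply: H => //=; first by case=> [|[|[|]]].
  by rewrite /greedy_add eB andbF.
rewrite ?h0 ?h1; have := rkA_lt e.1; have := rkB_lt e.2 => l1 l2.
split; first by lia.
split => //; split => //; apply: H => //=.
- by case=> [|[|[|]]].
- by move=> f i /negbTE-> /negbTE->.
rewrite /greedy_add eA eB /=; split => [a|b] /=.
  by rewrite (negbTE ab) eqxx rk_eq hA partner_add ?eA //; case: eqP => // _; rewrite addn1.
by rewrite eqxx rk_eq covB_add; case: eqP => //= _; rewrite eq_sym (negbTE ab) hB.
Qed.

(** Two prefixes are needed because, between the two halves of the handler, the greedy matching has
    already read one edge more than the semi-matching. The zero fields are the empty arrays for the
    wings and for [M2]. *)
Definition inv1 (s1 s2 : seq (A * B)) st : Prop :=
  [/\ reg st 2 = #|A|, out st = [::] & forall f i, 4 <= f -> fld st f i = 0] /\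
  [/\ stored 0 1 (greedy s1) st,
      forall a, fld st 2 (rk a) = code (partner (semi 3 s2) a) &
      forall b, fld st 3 (rk b) = degB (semi 3 s2) b].

Definition edge_in (e : A * B) st : Prop := reg st 0 = rk e.1 /\ reg st 1 = rk e.2.

Lemma wp_first_greedy s1 s2 e st : inv1 s1 s2 st -> edge_in e st ->
  wp n W (greedy_step 0 1)
    (fun st => inv1 (rcons s1 e) s2 st /\ edge_in e st) st.
Proof.
move=> [[h2 ho hz] [hs hS hd]] [e0 e1].
apply: (@wp_greedy_step 0 1 _ _ _ _ isT e0 e1 hs) => st' hr ho' hf hs'.
split; last by rewrite /edge_in !hr.
split; first by rewrite hr // ho'; split => // f i f4; rewrite hf ?hz //; lia.
split; first by rewrite (greedy_rcons s1 e); exact: hs'.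
- by move=> a; rewrite hf.
- by move=> b; rewrite hf.
Qed.

Lemma wp_first_semi s1 s2 e st : inv1 s1 s2 st -> edge_in e st ->
  wp n W semi_step (inv1 s1 (rcons s2 e)) st.
Proof.
move=> [[h2 ho hz] [hs hS hd]] [h0 h1]; rewrite /= h0 h1.
have lA := rkA_lt e.1; have lB := rkB_lt e.2; have d3 := degB_semi_le s2 e.2 (isT : 0 < 3).
split => //; rewrite hS code_partner0 negbK.
case: ifP => eA.
  have semiE : semi 3 (rcons s2 e) = semi 3 s2 by rewrite semi_rcons eA.
  by split; split => //; rewrite semiE.
split => //; split => //; rewrite eqb0 negbK hd; case: ifP => dB; last first.
  have semiE : semi 3 (rcons s2 e) = semi 3 s2.
    by rewrite semi_rcons ifF // eA /= subn1 /= -ltnS.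
  by split; split => //; rewrite semiE.
have semiE : semi 3 (rcons s2 e) = e |: semi 3 s2.
  by rewrite semi_rcons eA /= subn1 /= -ltnS dB.
split; first by lia.
split => //; split; first by lia.
split => //; split; split => //=.
- by case=> [|[|[|[|f]]]] i //= _; apply: hz.
- move=> a; rewrite semiE partner_add ?eA // rk_eq hS; case: eqP => // _.
  by rewrite addn1.
- move=> b; rewrite semiE degB_add ?notin_covA ?eA // rk_eq hd.
  by case: eqP => [->|_]; rewrite ?addn0.
Qed.

Lemma wp_first_step s e st : inv1 s s st -> edge_in e st ->
  wp n W (greedy_step 0 1;; semi_step) (inv1 (rcons s e) (rcons s e)) st.
Proof.
move=> hI he.
change (wp n W (greedy_step 0 1) (wp n W semi_step (inv1 (rcons s e) (rcons s e))) st).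
apply: wp_mono (wp_first_greedy hI he) => st' [hI' he'].
exact: wp_first_semi.
Qed.

(** The loop runs through A downwards, so an absent wing is certified only against vertices of rank
    at least [j]. At [j = 0] the absence is definitive. *)
Definition wing_inv (M1 : {set A * B}) (j : nat) w : Prop :=
  forall b, if w b is Some c then is_true ((c, b) \in M1)
            else forall c, j <= rk c -> (c, b) \notin M1.

Definition inv2 M0 w st : Prop :=
  [/\ reg st 2 = #|A|, stored 0 1 M0 st & forall b, fld st 4 (rk b) = code (w b)].

Definition loop1 (s : seq (A * B)) (j : nat) st : Prop :=
  let M1 := left_wings (greedy s) (semi 3 s) in
  [/\ reg st 8 = j, j <= #|A|, out st = [::],
      forall f i, 5 <= f -> fld st f i = 0 &
      forall a, fld st 2 (rk a) = code (partner (semi 3 s) a)] /\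
  exists2 w, inv2 (greedy s) w st & wing_inv M1 j w.

Lemma wp_wing_body s j st : loop1 s j.+1 st ->
  wp n W (SConst 4 1;; SArith OpSub 8 8 4;; wing_body) (loop1 s j) st.
Proof.
case=> [[h8 jA ho hz hS] [w [h2 [hA hB] h4] hw]].
pose a : A := enum_val (Ordinal jA).
have aj : rk a = j by rewrite /rk enum_valK.
rewrite /= h8 subn1 /= -aj; split=> //; split; first exact: rkA_lt.
set M0 := greedy s in hA hB hw *; set S := semi 3 s in hS hw *.
(* If [a] is incident to no wing, the array [w] stays valid one rank lower. This settles every
   branch that stores nothing. *)
have skip : (forall b, (a, b) \notin left_wings M0 S) ->
    wing_inv (left_wings M0 S) (rk a) w.
  move=> no b; case: (w b) (hw b) => // h c; rewrite leq_eqVlt => /orP[|]; last first.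
    by rewrite aj; apply: h.
  by rewrite rk_eq => /eqP <-.
have jA' : rk a <= #|A| by rewrite ltnW ?rk_lt.
rewrite hS code_partner0 negbK; case: ifP => aS; last first.
  split; first by split => //=.
  exists w; first by split.
  apply: skip => b; rewrite inE; apply/negP => /andP[abS _].
  by have := mem_covA abS; rewrite aS.
split; first exact: rkA_lt.
rewrite hA code_partner0 negbK; case: ifP => aM.
  split; first by split => //=.
  exists w; first by split.
  by apply: skip => b; rewrite !inE aM !andbF.
case eb: (partner S a) => [b|]; last first.
  by move/eqP: eb; rewrite partner_none aS.
have abS := partner_some eb.
rewrite /= subn1 /=; split => //; split; first exact: rkB_lt.
rewrite hB eqb0 negbK.
(* As [S] has degree at most one on A, inspecting the single stored partner of [a] suffices. *)
have onlyb b' : (a, b') \in S -> b' = b.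
  by move=> ab'; have [] := semi_inj1 ab' abS erefl.
case: ifP => bM; last first.
  split; first by split => //=.
  exists w; first by split.
  apply: skip => b'; rewrite inE; apply/negP => /and3P[/onlyb-> /=].
  by rewrite bM.
have := rkA_lt a; have := rkB_lt b => l1 l2.
rewrite addn1; split; first by lia.
split => //; split.
  by split => //= f i f5; rewrite ifN ?hz //; lia.
exists (fun b' => if b' == b then Some a else w b').
  by split => //= b'; rewrite rk_eq; case: eqP.
move=> b'; case: eqP => [->|ne]; first by rewrite !inE abS aM /= bM.
case: (w b') (hw b') => // h c; rewrite leq_eqVlt => /orP[|]; last first.
  by rewrite aj; apply: h.
rewrite rk_eq => /eqP <-; rewrite inE; apply/negP => /and3P[/onlyb bb _ _].
by case: ne.
Qed.

Definition second_edges M0 M1 : {set A * B} := setX (winged M0 M1) (~: covB M0).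

(** The existential over mates and wings collapses to two array lookups: the mate is unique, and a
    completed [w] records a wing wherever one exists. *)
Lemma winged_partner M0 M1 w a : matching M0 -> wing_inv M1 0 w ->
  (a \in winged M0 M1) = (if partner M0 a is Some b then w b != None else false).
Proof.
move=> m0 hw; rewrite inE; case e: (partner M0 a) => [b|]; last first.
  by move/eqP: e; rewrite partner_none => /negbTE->.
have ab := partner_some e; rewrite (mem_covA ab) /=; apply/existsP/idP.
  case=> b' /existsP[c /andP[ab' cb]].
  have [bb] := matching_inj1 m0 ab' ab erefl; move: cb; rewrite bb => cb.
  by case: (w b) (hw b) => // h; have := h c isT; rewrite cb.
case: (w b) (hw b) => // c cb _; exists b; apply/existsP; exists c.
by rewrite ab cb.
Qed.

Definition inv_second M0 M1 w (s : seq (A * B)) st : Prop :=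
  [/\ inv2 M0 w st, out st = [::] &
      stored 5 6 (greedy [seq e <- s | e \in second_edges M0 M1]) st].

Lemma wp_second_step M0 M1 w s e st : matching M0 -> wing_inv M1 0 w ->
  inv_second M0 M1 w s st -> edge_in e st ->
  wp n W second_step (inv_second M0 M1 w (rcons s e)) st.
Proof.
move=> m0 hw [[h2 hs h4] ho h5] [h0 h1]; have [hA hB] := hs.
have FE : (e \in second_edges M0 M1) =
    (e.1 \in winged M0 M1) && (e.2 \notin covB M0) by rewrite !inE.
rewrite (winged_partner _ m0 hw) in FE.
have skip (st' : sstate) : inv2 M0 w st' -> out st' = [::] ->
    stored 5 6 (greedy [seq e <- s | e \in second_edges M0 M1]) st' ->
    (e \in second_edges M0 M1) = false -> inv_second M0 M1 w (rcons s e) st'.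
  by move=> *; split => //; rewrite filter_rcons ifF.
rewrite /second_step; have gs := @wp_greedy_step 5 6.
move: (greedy_step 5 6) gs => gs gsP /=; rewrite h0 h1; split; first exact: rkB_lt.
rewrite hB eqb0 negbK; case: ifP => bM.
  by apply: skip => //; rewrite FE bM andbF.
split; first exact: rkA_lt.
rewrite hA; case ep: (partner M0 e.1) FE => [b|] /= FE; last exact: skip.
split=> //; rewrite subn1 /=; split; first exact: rkB_lt.
rewrite h4; case ew: (w b) FE => [c|] /= FE; last exact: skip.
apply: (gsP _ e) => //; [exact: h5|move=> st' hr ho' hf hs'; split].
- split; first by rewrite hr.
  + by split=> [a|b']; rewrite hf //=.
  + by move=> b'; rewrite hf //=.
- by rewrite ho'.
- by rewrite filter_rcons FE bM /= greedy_rcons.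
Qed.

(** The edge bc is emitted together with the edge at a, not when c is visited. The empty list for a
    missing wing is a default that never occurs when [M2] comes from the second pass. *)
Definition emitted M0 M2 w a : seq (A * B) :=
  match partner M0 a, partner M2 a with
  | Some b, None => [:: (a, b)]
  | Some b, Some d => (a, d) :: (if w b is Some c then [:: (c, b)] else [::])
  | None, _ => [::]
  end.

Definition loop2 M0 M2 w (j : nat) st : Prop :=
  [/\ reg st 8 = j, j <= #|A|, inv2 M0 w st, stored 5 6 M2 st &
      out st = map (@word_edge A B)
        (flatten [seq emitted M0 M2 w a | a <- rev (drop j (enum A))])].

Lemma wp_output_body M0 M2 w j st :
  (forall a b d, partner M0 a = Some b -> partner M2 a = Some d -> w b != None) ->
  loop2 M0 M2 w j.+1 st ->
  wp n W (SConst 4 1;; SArith OpSub 8 8 4;; output_body) (loop2 M0 M2 w j) st.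
Proof.
move=> hM2 [h8 jA [h2 [hA hB] h4] [h5 h6] ho].
pose a : A := enum_val (Ordinal jA).
have aj : rk a = j by rewrite /rk enum_valK.
have dr : drop j (enum A) = a :: drop j.+1 (enum A).
  rewrite (drop_nth a) -?cardE //; congr (_ :: _).
  by rewrite [RHS](enum_val_nth a).
have lA := rkA_lt a; have jA' := ltnW jA.
rewrite /= h8 subn1 /= -aj; split => //; split => //.
have fin (st' : sstate) :
    reg st' 8 = rk a -> inv2 M0 w st' -> stored 5 6 M2 st' ->
    out st' = out st ++ map (@word_edge A B) (emitted M0 M2 w a) ->
    loop2 M0 M2 w (rk a) st'.
  move=> g8 gi gs go; split => //; first by rewrite aj.
  by rewrite go ho aj dr rev_cons map_rcons flatten_rcons map_cat.
move: fin; rewrite /emitted hA; case e0: (partner M0 a) => [b|] /= fin; last first.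
  by apply: fin => //=; rewrite cats0.
split => //; split => //; rewrite h5.
case e2: (partner M2 a) fin => [d|] /= fin; last first.
  by apply: fin => //=; rewrite subn1 cats1.
split => //; rewrite !subn1 /=; split; first exact: rkB_lt.
split => //; apply: fin => //=; rewrite h4.
(* The hypothesis on [M2] ensures that the stored code of the wing is nonzero, so subtracting 1
   gives the rank of c. *)
have := hM2 _ _ _ e0 e2; case: (w b) => // c _.
by rewrite ?subn1 /= -!cats1 -catA.
Qed.

End Program.

(** * The emitted edges form the augmented matching *)

Section Output.
Context (A B : finType) (pi : seq (A * B)) (w : B -> option A).
Let M0 := greedy pi.
Let M1 := left_wings M0 (semi 3 pi).
Let M2 := greedy [seq e <- pi | e \in second_edges M0 M1].
Hypothesis hw : wing_inv M1 0 w.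

Lemma second_partner a d : partner M2 a = Some d ->
  exists b c, [/\ partner M0 a = Some b, w b = Some c, (a, b) \in M0 & (c, b) \in M1].
Proof.
move/partner_some => /mem_greedy_filter[]; rewrite in_setX => /andP[+ _] _.
rewrite (winged_partner _ (greedy_matching pi) hw) -/M0.
case e: (partner M0 a) => [b|] //; case ew: (w b) (hw b) => [c|] // cb _.
by exists b, c; split => //; apply: partner_some.
Qed.

(** The default only makes the function total: every edge of the second matching has its A-end
    matched in [M0]. *)
Definition chosen_mate (e : A * B) : B := odflt e.2 (partner M0 e.1).
Definition chosen_wing (e : A * B) : A := odflt e.1 (w (chosen_mate e)).

Definition output_set : {set A * B} :=
  (M0 :\: [set (e.1, chosen_mate e) | e in M2]) :|: M2
    :|: [set (chosen_wing e, chosen_mate e) | e in M2].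

Lemma chosenE e : e \in M2 ->
  exists b c, [/\ partner M0 e.1 = Some b, w b = Some c, chosen_mate e = b &
    chosen_wing e = c] /\ ((e.1, b) \in M0 /\ (c, b) \in M1).
Proof.
case: e => a d eM.
have /second_partner[b [c [pb wc ab cb]]] :=
  partner_in (matching_inj1 (greedy_matching _)) eM.
by exists b, c; rewrite /chosen_wing /chosen_mate /= pb /= wc.
Qed.

Lemma output_set_two_pass : two_pass_output pi output_set.
Proof.
exists chosen_mate, chosen_wing; split => // e eM.
by have [b [c [[_ _ -> ->] ?]]] := chosenE eM.
Qed.

Lemma card_output_set : #|output_set| = #|M0| + #|M2|.
Proof.
have [_ out1 _ _] := left_wings_props pi.
apply: (@augmentation_card _ _ M0 M1 M2 chosen_mate chosen_wing) => //.
- exact: greedy_matching.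
- exact: greedy_matching.
- by move=> e /mem_greedy_filter[]; rewrite !inE => /andP[].
- by move=> e /chosenE[b [c [[_ _ -> _] []]]].
- by move=> e /chosenE[b [c [[_ _ -> ->] []]]].
Qed.

Lemma size_emitted a :
  size (emitted M0 M2 w a) = (a \in covA M0) + (a \in covA M2).
Proof.
rewrite /emitted -[in RHS](negbK (a \in covA M0)) -[in RHS](negbK (a \in covA M2)).
rewrite -!partner_none.
case e2: (partner M2 a) => [d|]; last by case: (partner M0 a).
by have [b [c [-> -> _ _]]] := second_partner e2.
Qed.

Lemma emitted_perm :
  perm_eq (flatten [seq emitted M0 M2 w a | a <- rev (enum A)]) (enum output_set).
Proof.
set L := flatten _; have inj0 := matching_inj1 (greedy_matching pi).
have uo := enum_uniq output_set.
(* Duplicate-freeness of [L] is not shown directly: a list that contains a duplicate-free list and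
   is no longer than it must be a permutation of it. *)
have [sub le] : {subset enum output_set <= L} /\ size L <= size (enum output_set);
  last by rewrite perm_sym uniq_perm ?(leq_size_uniq uo) //; case: (uniq_min_size uo sub le).
split.
- move=> x; rewrite mem_enum => xM; apply/flatten_mapP.
  suff [a xa] : exists a, x \in emitted M0 M2 w a.
    by exists a => //; rewrite mem_rev mem_enum.
  move: xM; rewrite !inE => /orP[/orP[/andP[xR xM]|xM]|/imsetP[e eM ->]].
  + have p0 : partner M0 x.1 = Some x.2.
      by apply: partner_in => //; rewrite -surjective_pairing.
    exists x.1; rewrite /emitted p0; case e2: (partner M2 x.1) => [d|]; last first.
      by rewrite -surjective_pairing mem_head.
    case/negP: xR; apply/imsetP; exists (x.1, d); first exact: partner_some.
    by rewrite /chosen_mate /= p0 /= -surjective_pairing.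
  + have p2 : partner M2 x.1 = Some x.2.
      apply: partner_in; first exact/matching_inj1/greedy_matching.
      by rewrite -surjective_pairing.
    have [b [c [p0 wc _ _]]] := second_partner p2.
    by exists x.1; rewrite /emitted p0 p2 -surjective_pairing mem_head.
  + have [b [c [[p0 wc -> ->] _]]] := chosenE eM.
    exists e.1; rewrite /emitted p0.
    have -> : partner M2 e.1 = Some e.2.
      apply: partner_in; first exact/matching_inj1/greedy_matching.
      by rewrite -surjective_pairing.
    by rewrite wc !inE eqxx orbT.
- rewrite -cardE card_output_set size_flatten sumnE !big_map.
  rewrite (perm_big (enum A)) ?perm_rev //=.
  under eq_bigr do rewrite size_emitted.
  rewrite big_enum big_split /=.
  have mE (M : {set A * B}) : matching M -> \sum_a (a \in covA M) = #|M|.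
    move=> mM; rewrite -(card_covA mM) -sum1_card [RHS]big_mkcond /=.
    by apply: eq_bigr => a _; case: (a \in _).
  by rewrite !mE ?greedy_matching.
Qed.

End Output.

(** * Running the whole program within its resource bounds *)

Section Assembly.
Context (A B : finType) (m : ram) (te tb : nat) (pi : seq (A * B)).
Notation n := (#|A| + #|B|).
Notation W := (2 ^ bits m).
Hypothesis cellsE : cells m = 16 + 8 * n.
Hypothesis bitsE : cells m <= W.

Lemma triple_for_each_A (P : sstate -> Prop) (I : nat -> sstate -> Prop) body :
  wf body ->
  (forall j st, I j st -> reg st 8 = j) ->
  (forall st, P st -> reg st 2 = #|A| /\ I #|A| (setr (setr st 4 0) 8 #|A|)) ->
  (forall j st, I j.+1 st ->
    wp n W (SConst 4 1;; SArith OpSub 8 8 4;; body) (I j) st) ->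
  triple n m P (for_each_A body) (5 + #|A| * (cost body + 5)) (I 0).
Proof.
move=> wb I8 HP HI.
(* Each iteration adds to the body two instructions, two sequencing steps and the test. The
   remaining 5 are the initialisation (3), one sequencing step and the last test. *)
have -> : 5 + #|A| * (cost body + 5) =
    (3 + (#|A| * (cost (SConst 4 1;; SArith OpSub 8 8 4;; body)).+1).+1).+1.
  by rewrite /= !add1n !addnS addn0; lia.
apply: (@triple_seq n m P (I #|A|) (I 0) _ _ 3).
  apply: (@triple_wp n m cellsE bitsE (SConst 4 0;; SArith OpAdd 8 2 4)) => // st /HP[h2 hI] /=.
  rewrite h2 addn0; split => //; apply: leq_trans bitsE; rewrite cellsE; lia.
apply: (triple_while cellsE) => // j.
by apply: triple_wp => // st; apply: HI.
Qed.

Lemma two_pass_prog_correct : 120 <= te -> 5 + 100 * n <= tb ->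
  exists (M : {set A * B}) (o : seq (nat * nat)),
    [/\ run_prog m te tb two_pass_prog (#|A|, #|B|) [seq word_edge e | e <- pi] = Some o,
        perm_eq o [seq word_edge e | e <- enum M] & two_pass_output pi M].
Proof.
move=> hte htb; have hW : 16 + 8 * n <= W by rewrite -cellsE.
have nW : n < W by lia.
have word_lt (e : A * B) : (word_edge e).1 < W /\ (word_edge e).2 < W.
  by split; [apply: leq_trans (rkA_lt B e.1) _|apply: leq_trans (rkB_lt A e.2) _]; lia.
(* Both loop bodies cost well below 90. The edge handlers cost 113 and 96, within the bound 120. *)
have loop_time body : cost body <= 90 -> 5 + #|A| * (cost body + 5) <= tb by nia.
rewrite /run_prog.
have init : represents n m (State (fun=> 0) [::]) (SState (fun=> 0) (fun _ _ => 0) [::]).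
  by split => // i; apply: leq_ltn_trans nW.
have [s0 -> h0] : exists2 s', feed m (State (fun=> 0) [::]) (#|A|, #|B|) = Some s' &
    represents n m s' (setr (setr (SState (fun=> 0) (fun _ _ => 0) [::]) 0 #|A|) 1 #|B|).
  by apply: (feed_represents cellsE bitsE (e := (#|A|, #|B|)) init);
    apply: leq_ltn_trans nW; rewrite ?leq_addr ?leq_addl.
have pro : triple n m (fun st => [/\ reg st 0 = #|A|, forall f i, fld st f i = 0 &
    out st = [::]]) prologue_code tb (inv1 (A := A) (B := B) [::] [::]).
  apply: (triple_le (T := 3)); first by lia.
  apply: (triple_wp cellsE bitsE (c := prologue_code)) => // st [r0 f0 o0] /=; split; first by lia.
  have p0 a : partner (set0 : {set A * B}) a = None.
    by apply/eqP; rewrite partner_none /covA imset0 inE.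
  split; split => //=; first by rewrite r0 addn0.
  - by split => [a|b] /=; rewrite f0 ?p0 // /covB imset0 inE.
  - by move=> a; rewrite f0 p0.
  - by move=> b; rewrite f0 /degB /semi /=; apply/esym/eqP; rewrite cards_eq0;
      apply/eqP/setP => e; rewrite !inE.
rewrite /=.
have [s1 [st1 [-> h1 I1]]] := exec_triple pro h0 (And3 erefl (fun _ _ => erefl) erefl).
set M0 := greedy pi; set M1 := left_wings M0 (semi 3 pi).
have [s2 [st2 [-> h2 [[_ _ o2 z2 _] [w J2 hw]]]]] : exists s' st',
    [/\ run_pass m te tb [seq word_edge e | e <- pi] (Some s1)
          (compile (greedy_step 0 1;; semi_step), compile (for_each_A wing_body)) = Some s',
        represents n m s' st' & loop1 pi 0 st'].
  apply: (run_pass_triple cellsE bitsE (I := fun s => inv1 s s)) h1 I1 => //.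
  - move=> s e; apply: (triple_le (T := (cost (greedy_step 0 1;; semi_step)))).
      exact: leq_trans hte.
    apply: triple_wp => // st [st0 I0 ->].
    exact: wp_first_step.
  - apply: triple_le (loop_time wing_body isT) _.
    apply: triple_for_each_A => //; [by move=> j st [[]]| |by move=> j st; apply: wp_wing_body].
    move=> st [[r2 o z] [hs hS hd]]; split => //; split; first by split => //= f i /ltnW/z.
    (* Before the loop no wing is recorded, and the invariant is vacuous because every rank is below
       [#|A|]. *)
    exists (fun=> None); first by split => // b; rewrite /= z.
    by move=> b c; rewrite leqNgt rk_lt.
set M2 := greedy [seq e <- pi | e \in second_edges M0 M1].
have [s3 [st3 [-> h3 [_ _ _ _ o3]]]] : exists s' st',
    [/\ run_pass m te tb [seq word_edge e | e <- pi] (Some s2)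
          (compile second_step, compile (for_each_A output_body)) = Some s',
        represents n m s' st' & loop2 M0 M2 w 0 st'].
  apply: (run_pass_triple cellsE bitsE (I := inv_second M0 M1 w)) h2 _ => //.
  - move=> s e; apply: (triple_le (T := (cost second_step))).
      exact: leq_trans hte.
    apply: triple_wp => // st [st0 I0 ->].
    by apply: wp_second_step (greedy_matching pi) hw _ _.
  - apply: triple_le (loop_time output_body isT) _.
    apply: triple_for_each_A => //; first by move=> j st [].
      move=> st [[r2 hs h4] o hs2]; split => //; split => //.
      by rewrite drop_oversize // -cardE.
    move=> j st; apply: wp_output_body => // a b d p0 /(second_partner hw)[b' [c [p0' wc _ _]]].
    by move: p0; rewrite p0' => -[<-]; rewrite wc.
  - split => //; split => [a|b]; rewrite z2 //.
      rewrite (_ : partner _ _ = None) //.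
      by apply/eqP; rewrite partner_none /covA imset0 inE.
    by rewrite /covB imset0 inE.
exists (output_set pi w), (out st3); split.
- by case: h3 => _ _ _ <-.
- rewrite o3 drop0; apply/perm_map/(emitted_perm hw).
- exact: output_set_two_pass.
Qed.

End Assembly.

(** Words are long enough to address every cell: for positive [n] the right side exceeds [32 * n],
    and for [n = 0] it is 64. *)
Lemma ram_bits n : 16 + 8 * n <= 2 ^ (trunc_log 2 n + 6).
Proof.
case: n => [|n]; first by rewrite trunc_log0.
have := @trunc_log_ltn 2 n.+1 isT; rewrite expnD expnS; lia.
Qed.

Lemma two_pass_prog_semi_streaming :
  semi_streaming_algorithm 2 (fun _ => 1) (@two_pass_output) two_pass_prog.
Proof.
split => //.
exists (fun n => Ram (16 + 8 * n) (trunc_log 2 n + 6)), (fun=> 120),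
  (fun n => 5 + 100 * n); split.
(* For [n >= 2] there are at most [16 * n] cells, and the logarithm is positive, so a word has at
   most 7 times that many bits; 112 is [16 * 7]. *)
- exists 1; exists 112, 2 => n n2 /=; rewrite expn1.
  have l1 : 0 < trunc_log 2 n by rewrite trunc_log_gt0.
  by rewrite (_ : 112 = 16 * 7) // mulnACA; apply: leq_mul; lia.
- by exists 120, 0.
- by exists 105, 1 => n n1; lia.
- by move=> A B E pi _ /=; apply: two_pass_prog_correct => //=; apply: ram_bits.
Qed.

Import Order.TTheory GRing.Theory Num.Theory.
Local Open Scope ring_scope.

Theorem theorem4 :
  (forall (A B : finType) (E Mstar : {set A * B}) (pi : seq (A * B))
          (M : {set A * B}),
      maximum_matching E Mstar ->
      stream_of E pi ->
      two_pass_output pi M ->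
      [/\ M \subset E, matching M &
          (1 / 2 + 19 / 1000) * #|Mstar|%:R <= #|M|%:R :> rat]) /\
  (exists P : stream_prog,
      semi_streaming_algorithm 2 (fun _ => 1%N) (@two_pass_output) P).
Proof.
split; last by exists two_pass_prog; apply: two_pass_prog_semi_streaming.
move=> A B E Mstar pi M maxM st out.
have [ME mM _] := two_pass_correct st out; split; [exact: ME|exact: mM|].
have := two_pass_ratio maxM st out; rewrite -(ler_nat rat) !natrM.
have := ler0n rat #|Mstar|; lra.
Qed.
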